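(* Let $(X,d)$ be a metric space, let $g:X\to\mathbb{R}$ be bounded above, $\overline{g}=\sup_{x\in X}g(x)<+\infty$, and let $\theta(\cdot,\cdot):X\times X\to\mathbb{R}$ satisfy $\theta(x,y)\ge\theta$ for all $x,y\in X$, for some constant $\theta>0$. For $x\in X$ let $$W(x)=\{y\in X:\ g(y)-g(x)\ge\theta(x,y)\,d(x,y)\},\qquad S(x)=\{y\in X:\ g(y)-g(x)\ge\theta\,d(x,y)\},$$ so that $W(x)\subset S(x)$. Let $x_0\in X$ and let $(x_n)_{n\in\mathbb{N}}$ be a sequence with $x_{n+1}\in W(x_n)$ for all $n\in\mathbb{N}$. Then $$d(x_n,x_{n+1})\to 0\ \text{ as } n\to+\infty,$$ and there exists $g^{\ast}\le\overline{g}<+\infty$ such that $g(x_n)\to g^{\ast}$ as $n\to+\infty$.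
   Context: Interpretation: $X$ is a state space, $g$ is the instantaneous utility (upper boundedness of $g$ means ''limited needs''), $W(x)$ is the ''worthwhile-to-move'' set at $x$ and $S(x)$ is the set enclosing it; the lower bound $\theta>0$ on $\theta(x,y)$ expresses ''high local costs to move'' and limited intermediate sacrifices. The exploitation time is normalized to $1$. *)

(* Defs.v *)
From mathcomp Require Import all_boot all_order all_algebra.
From mathcomp Require Import all_classical all_reals all_analysis.

Set Implicit Arguments.
Unset Strict Implicit.
Unset Printing Implicit Defensive.

Import Order.TTheory GRing.Theory Num.Theory.
Import numFieldNormedType.Exports.

Local Open Scope classical_set_scope.
Local Open Scope ring_scope.

(* W(x): the change from x to y is worthwhile when the utility gain over the
   exploitation time, normalized to 1, covers the cost theta x y * d(x, y). *)
Definition worthwhile_set (R : realType) (X : metricType R)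
    (g : X -> R) (theta : X -> X -> R) (x : X) : set X :=
  [set y | g y - g x >= theta x y * mdist x y].

Definition enclosing_set (R : realType) (X : metricType R)
    (g : X -> R) (theta0 : R) (x : X) : set X :=
  [set y | g y - g x >= theta0 * mdist x y].

(* Main.v *)
Require Import Defs.
From mathcomp Require Import all_boot all_order all_algebra.
From mathcomp Require Import all_classical all_reals all_analysis.

Set Implicit Arguments.
Unset Strict Implicit.
Unset Printing Implicit Defensive.

Import Order.TTheory GRing.Theory Num.Theory.
Import numFieldNormedType.Exports.

Local Open Scope classical_set_scope.
Local Open Scope ring_scope.

(** A step from x to y in S(x) raises g by at least theta0 * d(x, y). Hence g is
nondecreasing along a trajectory (enclosing_nondecreasing) and, being bounded
above, converges along it, to a limit that cannot exceed the supremum. The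
increments of g then tend to 0, and theta0^-1 times them dominates the step
lengths (enclosing_steps_cvg0). Worthwhile trajectories are covered because
W(x) is contained in S(x). *)

Lemma worthwhile_subset_enclosing (R : realType) (X : metricType R)
    (g : X -> R) (theta : X -> X -> R) (theta0 : R) (x : X) :
  (forall y, theta0 <= theta x y) ->
  worthwhile_set g theta x `<=` enclosing_set g theta0 x.
Proof.
move=> theta_ge y; apply: le_trans.
by rewrite ler_wpM2r ?mdist_ge0.
Qed.

Lemma enclosing_nondecreasing (R : realType) (X : metricType R) (g : X -> R)
    (theta0 : R) (x_ : nat -> X) :
  (forall n, enclosing_set g theta0 (x_ n) (x_ n.+1)) ->
  0 <= theta0 ->
  nondecreasing_seq (fun n => g (x_ n)).
Proof.
move=> step theta0_ge0; apply/nondecreasing_seqP => n.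
by rewrite -subr_ge0 (le_trans _ (step n)) // mulr_ge0 ?mdist_ge0.
Qed.

(** The increments g (x_ n.+1) - g (x_ n) tend to 0 because a convergent
sequence and its shift have the same limit; dividing by theta0 turns them into an
upper bound for the distances. *)
Lemma enclosing_steps_cvg0 (R : realType) (X : metricType R) (g : X -> R)
    (theta0 : R) (x_ : nat -> X) :
  (forall n, enclosing_set g theta0 (x_ n) (x_ n.+1)) ->
  0 < theta0 -> cvgn (fun n => g (x_ n)) ->
  (fun n => mdist (x_ n) (x_ n.+1)) @ \oo --> (0 : R).
Proof.
move=> step theta0_gt0 gx_cvg.
have gain0 : (fun n => theta0^-1 * (g (x_ n.+1) - g (x_ n))) @ \oo --> (0 : R).
  rewrite -(mulr0 theta0^-1) -(subrr (limn (fun n => g (x_ n)))).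
  apply: cvgM; first exact: cvg_cst.
  apply: cvgB => //.
  by rewrite (cvg_shiftS (fun n => g (x_ n))).
apply: (squeeze_cvgr _ (cvg_cst 0) gain0).
by near=> n; rewrite mdist_ge0 /= ler_pdivlMl //; exact: step.
Unshelve. all: by end_near. Qed.

Theorem mainTheorem1 (R : realType) (X : metricType R)
    (g : X -> R) (g_bounded_above : has_ubound (range g))
    (theta : X -> X -> R) (theta0 : R) (theta0_gt0 : 0 < theta0)
    (theta_ge : forall x y : X, theta0 <= theta x y) :
  (forall x : X, worthwhile_set g theta x `<=` enclosing_set g theta0 x) /\
  (forall (x0 : X) (x_ : nat -> X), x_ 0%N = x0 ->
    (forall n : nat, worthwhile_set g theta (x_ n) (x_ n.+1)) ->
    ((fun n : nat => mdist (x_ n) (x_ n.+1)) @ \oo --> (0 : R)) /\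
    (exists gstar : R, gstar <= sup (range g) /\
       ((fun n : nat => g (x_ n)) @ \oo --> gstar))).
Proof.
have W_sub_S x : worthwhile_set g theta x `<=` enclosing_set g theta0 x.
  exact: worthwhile_subset_enclosing.
split=> // _ x_ _ x_step.
have S_step n : enclosing_set g theta0 (x_ n) (x_ n.+1) by exact: W_sub_S.
have gx_le_sup n : g (x_ n) <= sup (range g).
  by apply: ub_le_sup => //; exists (x_ n).
have gx_cvg : cvgn (fun n => g (x_ n)).
  apply: nondecreasing_is_cvgn; first exact: enclosing_nondecreasing S_step (ltW theta0_gt0).
  by exists (sup (range g)) => _ [n _ <-].
split; first exact: enclosing_steps_cvg0 S_step _ _.
exists (limn (fun n => g (x_ n))); split=> //.
by apply: limr_le => //; exact: nearW.
Qed.
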